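(* Let $\mathcal{E}$ be a locally cartesian closed category with a terminal object $\mathbf{1}$ and disjoint finite sums, and let $\mathbf{1}\leftarrow E\xrightarrow{p}B\to\mathbf{1}$ be a polynomial in $\mathcal{E}$ such that the diagonal $\delta_p\colon E\to E\times_BE$ is decidable. Then the derivative $Dp$ exists, and is given by the polynomial $$\mathbf{1}\leftarrow E\boxtimes_BE\xrightarrow{\ \neg\delta_p\ }E\times_BE\xrightarrow{\ \pi_1\ }E\to\mathbf{1},$$ i.e. by the polynomial with middle map $\pi_1\cdot\neg\delta_p\colon E\boxtimes_BE\to E$.
   Context: $\mathcal{E}$ is locally cartesian closed if it has pullbacks and each pullback functor $\Delta_p\colon\mathcal{E}/B\to\mathcal{E}/E$ has a right adjoint $\Pi_p$. For $q\colon X\to Y$, the negation is $\neg q:=\Pi_q(\mathbf{0}\to X)\in\mathcal{E}/Y$, with $\mathbf{0}$ initial. $E\boxtimes_BE$ denotes the domain of $\neg\delta_p$, where $\delta_p\colon E\to E\times_BE$ is the diagonal. A monomorphism $A\to X$, with negation $\neg A\to X$, is decidable if the induced map $A+\neg A\to X$ is invertible. $\mathbf{Poly}\,\mathcal{E}(1,1)$ is the category whose objects are polynomials $\mathbf{1}\leftarrow E\xrightarrow{p}B\to\mathbf{1}$ (equivalently morphisms $p\colon E\to B$ of $\mathcal{E}$), and whose morphisms $p\to p'$ are pullback squares from $p$ to $p'$. The product of $p$ with the linear polynomial $\mathbf{1}$ (that is, $\mathrm{id}\colon\mathbf{1}\to\mathbf{1}$) is $p\ast\mathbf{1}:=[p,\mathrm{id}_B]\colon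 E+B\to B$; this defines a functor $(-)\ast\mathbf{1}$ on $\mathbf{Poly}\,\mathcal{E}(1,1)$. The derivative $D$ is defined as the right adjoint to it, $(-)\ast\mathbf{1}\dashv D$; for a single $p$, ''the derivative $Dp$ exists'' means that there is an object $Dp$ with a universal arrow $\epsilon_p\colon Dp\ast\mathbf{1}\to p$ from the functor $(-)\ast\mathbf{1}$ to $p$. *)

(* Defs.v *)
From Stdlib Require Import ssreflect ProofIrrelevance.

Set Implicit Arguments.
Unset Strict Implicit.
Unset Printing Implicit Defensive.

Declare Scope cat_scope.
Delimit Scope cat_scope with cat.
Open Scope cat_scope.

Reserved Notation "A ~> B" (at level 90, right associativity).
Reserved Notation "g ∘ f" (at level 40, left associativity).

Record Category := MkCategory {
  Ob :> Type;
  Hom : Ob -> Ob -> Type;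
  idm : forall A, Hom A A;
  comp : forall A B C, Hom B C -> Hom A B -> Hom A C;
  comp_idl : forall A B (f : Hom A B), comp (idm B) f = f;
  comp_idr : forall A B (f : Hom A B), comp f (idm A) = f;
  comp_assoc : forall A B C D (h : Hom C D) (g : Hom B C) (f : Hom A B),
    comp h (comp g f) = comp (comp h g) f
}.

Arguments Hom {_} _ _.
Arguments idm {_} _.
Arguments comp {_ _ _ _} _ _.

Notation "A ~> B" := (Hom A B) : cat_scope.
Notation "g ∘ f" := (comp g f) : cat_scope.

Record Functor (C D : Category) := MkFunctor {
  fob :> C -> D;
  fmap : forall A B : C, (A ~> B) -> (fob A ~> fob B);
  fmap_id : forall A : C, fmap (idm A) = idm (fob A);
  fmap_comp : forall (A B B' : C) (g : B ~> B') (f : A ~> B),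
    fmap (g ∘ f) = fmap g ∘ fmap f
}.

Arguments fmap {_ _} _ {_ _} _.

Definition is_iso (C : Category) (A B : C) (f : A ~> B) : Prop :=
  exists g : B ~> A, g ∘ f = idm A /\ f ∘ g = idm B.

Definition is_monic (C : Category) (A B : C) (f : A ~> B) : Prop :=
  forall (X : C) (g h : X ~> A), f ∘ g = f ∘ h -> g = h.

Definition is_universal_arrow (C D : Category) (F : Functor C D) (X : D)
    (G : C) (eps : F G ~> X) : Prop :=
  forall (A : C) (f : F A ~> X), exists! g : A ~> G, eps ∘ fmap F g = f.

Lemma universal_arrow_inj (C D : Category) (F : Functor C D) (X : D) (G : C)
    (eps : F G ~> X) (A : C) (g h : A ~> G) :
  is_universal_arrow eps -> eps ∘ fmap F g = eps ∘ fmap F h -> g = h.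
Proof.
move=> U e; have [x [_ xu]] := U A (eps ∘ fmap F h).
by rewrite -(xu g e) -(xu h (eq_refl _)).
Qed.

Record RightAdjoint (C D : Category) (F : Functor C D) := MkRightAdjoint {
  radj :> Functor D C;
  counit : forall X : D, F (radj X) ~> X;
  counit_natural : forall (X Y : D) (f : X ~> Y),
    f ∘ counit X = counit Y ∘ fmap F (fmap radj f);
  counit_universal : forall X : D, is_universal_arrow (counit X)
}.

Record TerminalObject (C : Category) := MkTerminal {
  term :> C;
  bang : forall A : C, A ~> term;
  bang_unique : forall (A : C) (f : A ~> term), f = bang A
}.

Arguments bang {_} _ _.

(** The square with top [p1], left [p2], right [f] and bottom [g]. *)
Definition is_pullback (C : Category) (P A B Z : C)
    (p1 : P ~> A) (p2 : P ~> B) (f : A ~> Z) (g : B ~> Z) : Prop :=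
  f ∘ p1 = g ∘ p2 /\
  forall (Q : C) (q1 : Q ~> A) (q2 : Q ~> B), f ∘ q1 = g ∘ q2 ->
    exists! u : Q ~> P, p1 ∘ u = q1 /\ p2 ∘ u = q2.

Record Pullbacks (C : Category) := MkPullbacks {
  pb : forall A B Z : C, (A ~> Z) -> (B ~> Z) -> C;
  pb1 : forall (A B Z : C) (f : A ~> Z) (g : B ~> Z), pb f g ~> A;
  pb2 : forall (A B Z : C) (f : A ~> Z) (g : B ~> Z), pb f g ~> B;
  pb_comm : forall (A B Z : C) (f : A ~> Z) (g : B ~> Z),
    f ∘ pb1 f g = g ∘ pb2 f g;
  pb_pair : forall (A B Z : C) (f : A ~> Z) (g : B ~> Z) (Q : C)
    (q1 : Q ~> A) (q2 : Q ~> B), f ∘ q1 = g ∘ q2 -> Q ~> pb f g;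
  pb_pair1 : forall (A B Z : C) (f : A ~> Z) (g : B ~> Z) (Q : C)
    (q1 : Q ~> A) (q2 : Q ~> B) (e : f ∘ q1 = g ∘ q2),
    pb1 f g ∘ pb_pair e = q1;
  pb_pair2 : forall (A B Z : C) (f : A ~> Z) (g : B ~> Z) (Q : C)
    (q1 : Q ~> A) (q2 : Q ~> B) (e : f ∘ q1 = g ∘ q2),
    pb2 f g ∘ pb_pair e = q2;
  pb_unique : forall (A B Z : C) (f : A ~> Z) (g : B ~> Z) (Q : C)
    (u v : Q ~> pb f g),
    pb1 f g ∘ u = pb1 f g ∘ v -> pb2 f g ∘ u = pb2 f g ∘ v -> u = v
}.

Arguments pb {_} _ {_ _ _} _ _.
Arguments pb1 {_} _ {_ _ _} _ _.
Arguments pb2 {_} _ {_ _ _} _ _.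
Arguments pb_pair {_} _ {_ _ _ _ _ _ _ _} _.
Arguments pb_comm {_} _ {_ _ _} _ _.
Arguments pb_pair1 {_ _ _ _ _ _ _ _ _ _} _.
Arguments pb_pair2 {_ _ _ _ _ _ _ _ _ _} _.
Arguments pb_unique {_ _ _ _ _ _ _ _ _ _} _ _.

Record DisjointFiniteSums (C : Category) := MkDisjointFiniteSums {
  init : C;
  from_init : forall A : C, init ~> A;
  from_init_unique : forall (A : C) (f : init ~> A), f = from_init A;
  sum : C -> C -> C;
  inj1 : forall A B : C, A ~> sum A B;
  inj2 : forall A B : C, B ~> sum A B;
  copair : forall A B X : C, (A ~> X) -> (B ~> X) -> (sum A B ~> X);
  copair1 : forall (A B X : C) (f : A ~> X) (g : B ~> X),
    copair f g ∘ inj1 A B = f;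
  copair2 : forall (A B X : C) (f : A ~> X) (g : B ~> X),
    copair f g ∘ inj2 A B = g;
  copair_unique : forall (A B X : C) (u v : sum A B ~> X),
    u ∘ inj1 A B = v ∘ inj1 A B -> u ∘ inj2 A B = v ∘ inj2 A B -> u = v;
  inj1_monic : forall A B : C, is_monic (inj1 A B);
  inj2_monic : forall A B : C, is_monic (inj2 A B);
  inj_disjoint : forall A B : C,
    is_pullback (from_init A) (from_init B) (inj1 A B) (inj2 A B)
}.

Arguments init {_} _.
Arguments from_init {_} _ _.
Arguments sum {_} _ _ _.
Arguments inj1 {_} _ _ _.
Arguments inj2 {_} _ _ _.
Arguments copair {_} _ {_ _ _} _ _.
Arguments copair1 {_ _ _ _ _} _ _.
Arguments copair2 {_ _ _ _ _} _ _.
Arguments copair_unique {_ _ _ _ _ _ _} _ _.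

Definition sum_map (C : Category) (S : DisjointFiniteSums C) (A B A' B' : C)
    (f : A ~> A') (g : B ~> B') : sum S A B ~> sum S A' B' :=
  copair S (inj1 S A' B' ∘ f) (inj2 S A' B' ∘ g).

Section Slice.
Context (C : Category) (B : C).

Record SliceOb := MkSliceOb { sdom : C; sarr : sdom ~> B }.

Record SliceHom (X Y : SliceOb) := MkSliceHom {
  shom : sdom X ~> sdom Y;
  shom_comm : sarr Y ∘ shom = sarr X
}.

Lemma slice_hom_eq (X Y : SliceOb) (f g : SliceHom X Y) :
  shom f = shom g -> f = g.
Proof.
case: f g => [f ef] [g eg] /= e; move: ef eg; rewrite e => ef eg.
by rewrite (proof_irrelevance _ ef eg).
Qed.

Definition slice_id (X : SliceOb) : SliceHom X X :=
  MkSliceHom (comp_idr (sarr X)).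

Lemma slice_comp_comm (X Y Z : SliceOb) (g : SliceHom Y Z) (f : SliceHom X Y) :
  sarr Z ∘ (shom g ∘ shom f) = sarr X.
Proof. by rewrite comp_assoc !shom_comm. Qed.

Definition slice_comp (X Y Z : SliceOb) (g : SliceHom Y Z) (f : SliceHom X Y) :
  SliceHom X Z := MkSliceHom (slice_comp_comm g f).

Definition Slice : Category.
Proof.
refine (@MkCategory SliceOb SliceHom slice_id slice_comp _ _ _).
- by move=> X Y f; apply: slice_hom_eq; apply: comp_idl.
- by move=> X Y f; apply: slice_hom_eq; apply: comp_idr.
- by move=> X Y Z W h g f; apply: slice_hom_eq; apply: comp_assoc.
Defined.

End Slice.

Arguments sdom {_ _} _.
Arguments sarr {_ _} _.
Arguments shom {_ _ _ _} _.
Arguments MkSliceOb {_ _ _} _.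

Section PullbackFunctor.
Context (C : Category) (PB : Pullbacks C) (E B : C) (p : E ~> B).

Definition pullback_ob (X : Slice B) : Slice E := MkSliceOb (pb1 PB p (sarr X)).

Lemma pullback_map_comm (X Y : Slice B) (f : X ~> Y) :
  p ∘ pb1 PB p (sarr X) = sarr Y ∘ (shom f ∘ pb2 PB p (sarr X)).
Proof. by rewrite comp_assoc shom_comm pb_comm. Qed.

Definition pullback_map (X Y : Slice B) (f : X ~> Y) :
    pullback_ob X ~> pullback_ob Y :=
  @MkSliceHom C E (pullback_ob X) (pullback_ob Y)
    (pb_pair PB (pullback_map_comm f)) (pb_pair1 (pullback_map_comm f)).

Definition pullback_functor : Functor (Slice B) (Slice E).
Proof.
refine (@MkFunctor (Slice B) (Slice E) pullback_ob pullback_map _ _).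
- move=> X; apply: slice_hom_eq; apply: pb_unique => /=.
  + by rewrite pb_pair1 comp_idr.
  + by rewrite pb_pair2 comp_idr comp_idl.
- move=> X Y Z g f; apply: slice_hom_eq; apply: pb_unique => /=.
  + by rewrite comp_assoc !pb_pair1.
  + by rewrite comp_assoc !pb_pair2 -!comp_assoc pb_pair2.
Defined.

End PullbackFunctor.

(** The pullbacks and the right adjoints are chosen data; a statement
    quantified over this record holds for every such choice. *)
Record LocallyCartesianClosed (C : Category) := MkLCC {
  lcc_pullbacks :> Pullbacks C;
  Pi : forall (E B : C) (p : E ~> B),
    RightAdjoint (pullback_functor lcc_pullbacks p)
}.

Arguments Pi {_} _ {_ _} _.

Section Negation.
Context (C : Category) (L : LocallyCartesianClosed C) (S : DisjointFiniteSums C).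

(** The negation of [q] is Π_q applied to [0 --> X], an object over [Y]. *)
Definition neg (X Y : C) (q : X ~> Y) : Slice Y :=
  Pi L q (MkSliceOb (from_init S X)).

Definition decidable (A X : C) (m : A ~> X) : Prop :=
  is_monic m /\ is_iso (copair S m (sarr (neg m))).

Definition diagonal (E B : C) (p : E ~> B) : E ~> pb L p p :=
  pb_pair L (eq_refl (p ∘ idm E)).

(** The object E ⊠_B E. *)
Definition boxtimes (E B : C) (p : E ~> B) : C := sdom (neg (diagonal p)).

Definition neg_diagonal (E B : C) (p : E ~> B) : boxtimes p ~> pb L p p :=
  sarr (neg (diagonal p)).

End Negation.

Lemma is_pullback_id (C : Category) (E B : C) (p : E ~> B) :
  is_pullback (idm E) p p (idm B).
Proof.
split; first by rewrite comp_idl comp_idr.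
move=> Q q1 q2; rewrite comp_idl => e; exists q1; split.
- by rewrite comp_idl.
- by move=> u [<- _]; rewrite comp_idl.
Qed.

Lemma is_pullback_comp (C : Category) (E B E' B' E'' B'' : C)
    (p : E ~> B) (p' : E' ~> B') (p'' : E'' ~> B'')
    (e : E ~> E') (b : B ~> B') (e' : E' ~> E'') (b' : B' ~> B'') :
  is_pullback e p p' b -> is_pullback e' p' p'' b' ->
  is_pullback (e' ∘ e) p p'' (b' ∘ b).
Proof.
move=> [c1 u1] [c2 u2]; split.
  by rewrite comp_assoc c2 -!comp_assoc c1.
move=> Q q1 q2; rewrite -comp_assoc => h.
have [v [[v1 v2] vu]] := u2 _ _ _ h.
have [w [[w1 w2] wu]] := u1 _ _ _ v2.
exists w; split; first by rewrite -comp_assoc w1.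
move=> x [x1 x2]; apply: wu; split => //.
apply: eq_sym; apply: vu; split; first by rewrite comp_assoc.
by rewrite comp_assoc c1 -comp_assoc x2.
Qed.

Section Poly.
Context (C : Category) (T : TerminalObject C).

(** The polynomial [1 <-- E --> B --> 1].  The legs into [1] are unique, so a
    pullback square between middle maps is automatically compatible with them
    and [PolyHom] need not mention them. *)
Record PolyOb := MkPoly {
  pE : C;
  pB : C;
  pleft : pE ~> T;
  pmid : pE ~> pB;
  pright : pB ~> T
}.

Record PolyHom (p q : PolyOb) := MkPolyHom {
  phE : pE p ~> pE q;
  phB : pB p ~> pB q;
  ph_pullback : is_pullback phE (pmid p) (pmid q) phB
}.

Lemma poly_hom_eq (p q : PolyOb) (f g : PolyHom p q) :
  phE f = phE g -> phB f = phB g -> f = g.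
Proof.
case: f g => [fe fb ef] [ge gb eg] /= e1 e2; move: ef eg; rewrite e1 e2 => ef eg.
by rewrite (proof_irrelevance _ ef eg).
Qed.

Definition poly_id (p : PolyOb) : PolyHom p p :=
  MkPolyHom (is_pullback_id (pmid p)).

Definition poly_comp (p q r : PolyOb) (g : PolyHom q r) (f : PolyHom p q) :
  PolyHom p r := MkPolyHom (is_pullback_comp (ph_pullback f) (ph_pullback g)).

Definition Poly : Category.
Proof.
refine (@MkCategory PolyOb PolyHom poly_id poly_comp _ _ _).
- by move=> p q f; apply: poly_hom_eq; apply: comp_idl.
- by move=> p q f; apply: poly_hom_eq; apply: comp_idr.
- by move=> p q r s h g f; apply: poly_hom_eq; apply: comp_assoc.
Defined.

End Poly.

Arguments MkPoly {_ _ _ _} _ _ _.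
Arguments pE {_ _} _.
Arguments pB {_ _} _.
Arguments pmid {_ _} _.
Arguments phE {_ _ _ _} _.
Arguments phB {_ _ _ _} _.

Lemma iso_is_pullback (C : Category) (P P' A B Z : C)
    (p1 : P ~> A) (p2 : P ~> B) (f : A ~> Z) (g : B ~> Z) (k : P' ~> P) :
  is_pullback p1 p2 f g -> is_iso k ->
  is_pullback (p1 ∘ k) (p2 ∘ k) f g.
Proof.
move=> [c u] [k' [k'k kk']]; split; first by rewrite !comp_assoc c.
move=> Q q1 q2 h; have [v [[v1 v2] vu]] := u _ _ _ h.
exists (k' ∘ v); split.
  by rewrite -!comp_assoc (comp_assoc k) kk' comp_idl.
move=> x [x1 x2]; rewrite (vu (k ∘ x)); last by rewrite comp_assoc k'k comp_idl.
by rewrite !comp_assoc.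
Qed.

Lemma pb_is_pullback (C : Category) (PB : Pullbacks C) (A B Z : C)
    (f : A ~> Z) (g : B ~> Z) :
  is_pullback (pb1 PB f g) (pb2 PB f g) f g.
Proof.
split; first exact: pb_comm.
move=> Q q1 q2 h; exists (pb_pair PB h); split.
  by rewrite pb_pair1 pb_pair2.
by move=> x [x1 x2]; apply: pb_unique; rewrite ?pb_pair1 ?pb_pair2.
Qed.

Lemma is_pullback_sym (C : Category) (P A B Z : C)
    (p1 : P ~> A) (p2 : P ~> B) (f : A ~> Z) (g : B ~> Z) :
  is_pullback p1 p2 f g -> is_pullback p2 p1 g f.
Proof.
move=> [c u]; split; first by [].
move=> Q q1 q2 h; have [v [[v1 v2] vu]] := u _ _ _ (eq_sym h).
by exists v; split => // x [x1 x2]; apply: vu.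
Qed.

(** Sums are stable under pullback, because a pullback functor is a left
    adjoint. *)
Section SumStable.
Context (C : Category) (L : LocallyCartesianClosed C) (S : DisjointFiniteSums C).
Context (B' B : C) (b : B' ~> B).
Context (E1 E2 F1 F2 : C) (z1 : E1 ~> B) (z2 : E2 ~> B).
Context (w1 : F1 ~> B') (w2 : F2 ~> B') (e1 : F1 ~> E1) (e2 : F2 ~> E2).

Lemma sum_is_pullback :
  is_pullback e1 w1 z1 b -> is_pullback e2 w2 z2 b ->
  is_pullback (sum_map S e1 e2) (copair S w1 w2) (copair S z1 z2) b.
Proof.
move=> h1 h2.
have [c1 u1] := h1; have [c2 u2] := h2.
pose D := pullback_functor L b.
pose Z1 : Slice B := MkSliceOb z1.
pose Z2 : Slice B := MkSliceOb z2.
pose Z : Slice B := MkSliceOb (copair S z1 z2).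
pose W : Slice B' := MkSliceOb (copair S w1 w2).
pose i1 : Z1 ~> Z := @MkSliceHom C B Z1 Z (inj1 S E1 E2) (copair1 z1 z2).
pose i2 : Z2 ~> Z := @MkSliceHom C B Z2 Z (inj2 S E1 E2) (copair2 z1 z2).
have jointly_epic (Y : Slice B') (f g : D Z ~> Y) :
    f ∘ fmap D i1 = g ∘ fmap D i1 -> f ∘ fmap D i2 = g ∘ fmap D i2 -> f = g.
  move=> q1 q2.
  have U := @counit_universal _ _ _ (Pi L b) Y.
  have [f' [ef _]] := U _ f; have [g' [eg _]] := U _ g.
  suff fg : f' = g' by rewrite -ef -eg fg.
  have r1 : f' ∘ i1 = g' ∘ i1.
    by apply: (universal_arrow_inj U); rewrite !fmap_comp !comp_assoc ef eg.
  have r2 : f' ∘ i2 = g' ∘ i2.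
    by apply: (universal_arrow_inj U); rewrite !fmap_comp !comp_assoc ef eg.
  apply: slice_hom_eq; apply: copair_unique.
    by have := f_equal (@shom _ _ _ _) r1.
  by have := f_equal (@shom _ _ _ _) r2.
have copairing (Y : Slice B') (f1 : D Z1 ~> Y) (f2 : D Z2 ~> Y) :
    exists f : D Z ~> Y, f ∘ fmap D i1 = f1 /\ f ∘ fmap D i2 = f2.
  have U := @counit_universal _ _ _ (Pi L b) Y.
  have [g1 [eg1 _]] := U _ f1; have [g2 [eg2 _]] := U _ f2.
  have gc : sarr (Pi L b Y) ∘ copair S (shom g1) (shom g2) = sarr Z.
    apply: copair_unique; rewrite -comp_assoc ?copair1 ?copair2.
      exact: (shom_comm g1).
    exact: (shom_comm g2).
  pose g : Z ~> Pi L b Y := @MkSliceHom C B Z (Pi L b Y) _ gc.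
  have gi1 : g ∘ i1 = g1 by apply: slice_hom_eq; apply: copair1.
  have gi2 : g ∘ i2 = g2 by apply: slice_hom_eq; apply: copair2.
  exists (counit (Pi L b) Y ∘ fmap D g).
  by rewrite -!comp_assoc -!fmap_comp gi1 gi2.
have [v1 [[v11 v12] _]] := u1 _ _ _ (eq_sym (pb_comm L b z1)).
have [v2 [[v21 v22] _]] := u2 _ _ _ (eq_sym (pb_comm L b z2)).
have n1 : sarr W ∘ (inj1 S F1 F2 ∘ v1) = sarr (D Z1).
  by rewrite comp_assoc copair1.
have n2 : sarr W ∘ (inj2 S F1 F2 ∘ v2) = sarr (D Z2).
  by rewrite comp_assoc copair2.
have [r [r1 r2]] := copairing W (@MkSliceHom C B' (D Z1) W _ n1)
                                (@MkSliceHom C B' (D Z2) W _ n2).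
have {}r1 := f_equal (@shom _ _ _ _) r1.
have {}r2 := f_equal (@shom _ _ _ _) r2.
rewrite /= in r1 r2.
have kc : b ∘ copair S w1 w2 = copair S z1 z2 ∘ sum_map S e1 e2.
  apply: copair_unique; rewrite -!comp_assoc ?copair1 ?copair2 comp_assoc.
    by rewrite copair1.
  by rewrite copair2.
pose k := pb_pair L kc.
have ki1 : k ∘ inj1 S F1 F2 ∘ v1 = shom (fmap D i1).
  apply: pb_unique; rewrite /= !comp_assoc.
    by rewrite !pb_pair1 copair1.
  by rewrite !pb_pair2 copair1 -comp_assoc v11.
have ki2 : k ∘ inj2 S F1 F2 ∘ v2 = shom (fmap D i2).
  apply: pb_unique; rewrite /= !comp_assoc.
    by rewrite !pb_pair1 copair2.
  by rewrite !pb_pair2 copair2 -comp_assoc v21.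
have iso_k : is_iso k.
{ exists (shom r); split.
  - have t1 : v1 ∘ pb_pair L (eq_sym c1) = idm F1.
      have [x [_ xu]] := u1 _ _ _ c1.
      rewrite -(xu (idm F1)) ?comp_idr //; apply: eq_sym; apply: xu.
      by rewrite !comp_assoc v11 v12 pb_pair1 pb_pair2.
    have t2 : v2 ∘ pb_pair L (eq_sym c2) = idm F2.
      have [x [_ xu]] := u2 _ _ _ c2.
      rewrite -(xu (idm F2)) ?comp_idr //; apply: eq_sym; apply: xu.
      by rewrite !comp_assoc v21 v22 pb_pair1 pb_pair2.
    apply: copair_unique; rewrite comp_idl.
      rewrite -[LHS]comp_idr -t1 !comp_assoc -(comp_assoc _ k) -(comp_assoc _ _ v1).
      by rewrite ki1 /= r1 -comp_assoc t1 comp_idr.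
    rewrite -[LHS]comp_idr -t2 !comp_assoc -(comp_assoc _ k) -(comp_assoc _ _ v2).
    by rewrite ki2 /= r2 -comp_assoc t2 comp_idr.
  - have kr : sarr (D Z) ∘ (k ∘ shom r) = sarr (D Z).
      by rewrite comp_assoc pb_pair1; apply: (shom_comm r).
    have := jointly_epic _ (@MkSliceHom C B' (D Z) (D Z) _ kr) (idm _).
    move=> H; have {}H := f_equal (@shom _ _ _ _) (H _ _); apply: H.
      apply: slice_hom_eq; rewrite /= comp_idl -comp_assoc r1.
      by rewrite comp_assoc ki1.
    apply: slice_hom_eq; rewrite /= comp_idl -comp_assoc r2.
    by rewrite comp_assoc ki2.
}
have := iso_is_pullback (pb_is_pullback L b (copair S z1 z2)) iso_k.
by rewrite pb_pair1 pb_pair2; apply: is_pullback_sym.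
Qed.

End SumStable.

Section Derivative.
Context (C : Category) (L : LocallyCartesianClosed C) (T : TerminalObject C)
  (S : DisjointFiniteSums C).

(** The product of a polynomial [p] with the linear polynomial [1]: its middle
    map is [[p, id] : E + B --> B]. *)
Definition times_one_ob (p : Poly T) : Poly T :=
  MkPoly (bang T (sum S (pE p) (pB p)))
         (copair S (pmid p) (idm (pB p)))
         (bang T (pB p)).

Definition times_one_map (p q : Poly T) (f : p ~> q) :
    times_one_ob p ~> times_one_ob q :=
  @MkPolyHom C T (times_one_ob p) (times_one_ob q)
    (sum_map S (phE f) (phB f)) (phB f)
    (sum_is_pullback L S (ph_pullback f)
       (is_pullback_sym (is_pullback_id (phB f)))).

Definition times_one : Functor (Poly T) (Poly T).
Proof.
refine (@MkFunctor (Poly T) (Poly T) times_one_ob times_one_map _ _).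
- move=> p; apply: poly_hom_eq => //=.
  by apply: copair_unique; rewrite ?copair1 ?copair2 comp_idl comp_idr.
- move=> p q r g f; apply: poly_hom_eq => //=.
  by apply: copair_unique; rewrite -!comp_assoc ?copair1 ?copair2 !comp_assoc
    ?copair1 ?copair2.
Defined.

(** [d] is the value at [p] of the (partial) right adjoint of [times_one]. *)
Definition is_derivative (p d : Poly T) : Prop :=
  exists eps : times_one d ~> p, is_universal_arrow eps.

End Derivative.

(* Main.v *)
From Stdlib Require Import ssreflect.
Require Import Defs.

(** The inclusions [ν = neg_diagonal] and [δ = diagonal] present [E ×_B E] as
    [(E ⊠_B E) + E], so the kernel pair square of [p] is a pullback square
    [Dp ∗ 1 --> p] with components [[π2 ν, id]] and [p]; this is the counit.
    A pullback square [A ∗ 1 --> p] with top component [[u, v]] forces the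
    transpose to be [(<v q, u>, v)], where [q] is the middle map of [A].  Since
    [<q, id>] and [<u, v>] are jointly monic and the two summands are disjoint,
    [<v q, u>] is disjoint from the diagonal, hence factors through its
    negation; conversely a point of the pullback of [π1 ν] along [v] lies in the
    first summand because [ν] is disjoint from the diagonal. *)

Set Implicit Arguments.
Unset Strict Implicit.
Unset Printing Implicit Defensive.

Local Open Scope cat_scope.

Section Prerequisites.
Context (C : Category) (L : LocallyCartesianClosed C)
  (S : DisjointFiniteSums C).

(* [P] is, over itself, the pullback of the initial object [id] of the slice
   over [init S]; being a left adjoint, pullback along [h] keeps it initial. *)
Lemma strict_initial (T : TerminalObject C) (P A : C) (h : P ~> init S)
    (f g : P ~> A) : f = g.
Proof.
pose Z : Slice (init S) := MkSliceOb (idm (init S)).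
(* [Y] is [P × A] over [P], so that arrows [P ~> A] become arrows over [P]. *)
pose Y : Slice P := MkSliceOb (pb1 L (bang T P) (bang T A)).
have bang_eq (X : C) (a b : X ~> T) : a = b.
  by rewrite (bang_unique a) (bang_unique b).
pose proj := pb1 L h (sarr Z).
pose lift (k : P ~> A) :=
  pb_pair L (bang_eq _ (bang T P ∘ proj) (bang T A ∘ (k ∘ proj))).
pose m (k : P ~> A) : pullback_functor L h Z ~> Y :=
  @MkSliceHom C P (pullback_functor L h Z) Y (lift k) (pb_pair1 _).
have U := @counit_universal _ _ _ (Pi L h) Y.
have [f' [ef _]] := U Z (m f); have [g' [eg _]] := U Z (m g).
have fg : f' = g'.
  apply: slice_hom_eq.
  by rewrite (from_init_unique (shom f')) (from_init_unique (shom g')).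
have mm : m f = m g by rewrite -ef -eg fg.
have e := f_equal (fun k : SliceHom _ Y =>
  pb2 L (bang T P) (bang T A) ∘ shom k) mm.
rewrite /= !pb_pair2 in e.
have c : h ∘ idm P = sarr Z ∘ h by rewrite comp_idl comp_idr.
have e' := f_equal (fun k => k ∘ pb_pair L c) e.
by rewrite /= -!comp_assoc pb_pair1 !comp_idr in e'.
Qed.

(** [x] and [y] give a point of the pullback of the negation along [q], which the counit sends to
    [init S]. *)
Lemma neg_disjoint (X Y Q : C) (q : X ~> Y) (x : Q ~> X)
    (y : Q ~> sdom (neg L S q)) :
  q ∘ x = sarr (neg L S q) ∘ y -> inhabited (Q ~> init S).
Proof.
move=> e.
exact: (inhabits (shom (counit (Pi L q) (MkSliceOb (from_init S X)))
                  ∘ pb_pair L e)).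
Qed.

(** Two lifts of one arrow transpose to parallel arrows out of an object over [init S]; these agree
    by strictness. *)
Lemma neg_monic (T : TerminalObject C) (X Y : C) (q : X ~> Y) :
  is_monic (sarr (neg L S q)).
Proof.
move=> Q g h e.
pose W : Slice Y := MkSliceOb (sarr (neg L S q) ∘ h).
pose g' : W ~> neg L S q := @MkSliceHom C Y W (neg L S q) g e.
pose h' : W ~> neg L S q := @MkSliceHom C Y W (neg L S q) h (eq_refl _).
suff gh : g' = h' by exact: (f_equal (@shom _ _ _ _) gh).
apply: (universal_arrow_inj
          (@counit_universal _ _ _ (Pi L q) (MkSliceOb (from_init S X)))).
apply: slice_hom_eq; apply: (strict_initial T).
exact: (shom (counit (Pi L q) (MkSliceOb (from_init S X)) ∘ fmap _ g')).
Qed.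

(** The pullback of [w] along [q] maps to [init S], over [X] by strictness; the transpose of that
    map is the lift. *)
Lemma neg_lift (T : TerminalObject C) (X Y Q : C) (q : X ~> Y) (w : Q ~> Y) :
  (forall (R : C) (x : R ~> X) (y : R ~> Q), q ∘ x = w ∘ y ->
     inhabited (R ~> init S)) ->
  exists g : Q ~> sdom (neg L S q), sarr (neg L S q) ∘ g = w.
Proof.
move=> disj.
have [h] := disj _ _ _ (pb_comm L q w).
pose W : Slice Y := MkSliceOb w.
have c : from_init S X ∘ h = sarr (pullback_functor L q W).
  exact: (strict_initial T h).
have [g _] := @counit_universal _ _ _ (Pi L q) (MkSliceOb (from_init S X)) W
  (@MkSliceHom C X (pullback_functor L q W) (MkSliceOb (from_init S X)) h c).
by exists (shom g); apply: (shom_comm g).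
Qed.

(* Stability of sums decomposes [Q] into the preimages of [F] and [A]; the
   latter is initial by assumption. *)
Lemma factor_inj1 (T : TerminalObject C) (Q F A : C) (w : Q ~> sum S F A) :
  (forall (R : C) (x : R ~> A) (y : R ~> Q), inj2 S F A ∘ x = w ∘ y ->
     inhabited (R ~> init S)) ->
  exists s : Q ~> F, inj1 S F A ∘ s = w.
Proof.
move=> disj.
have [h] := disj _ _ _ (pb_comm L (inj2 S F A) w).
have [_ U] := sum_is_pullback L S (pb_is_pullback L (inj1 S F A) w)
                                  (pb_is_pullback L (inj2 S F A) w).
(* This copairing is the identity, so [w] and [idm Q] form a cone over the pullback. *)
have e : copair S (inj1 S F A) (inj2 S F A) ∘ w = w ∘ idm Q.
  rewrite comp_idr -[RHS]comp_idl; congr (_ ∘ _).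
  by apply: copair_unique; rewrite ?copair1 ?copair2 comp_idl.
have [s [[sw _] _]] := U _ _ _ e.
exists (copair S (pb1 L (inj1 S F A) w) (from_init S F ∘ h) ∘ s).
rewrite -[RHS]sw comp_assoc; congr (_ ∘ _).
apply: copair_unique; rewrite -comp_assoc ?copair1 ?copair2 //.
exact: (strict_initial T h).
Qed.

(** Reconciles [decidable], which puts the diagonal first, with [times_one], which puts it last. *)
Lemma copair_swap_iso (A B X : C) (f : A ~> X) (g : B ~> X) :
  is_iso (copair S f g) -> is_iso (copair S g f).
Proof.
move=> [k [kf fk]].
have swap : copair S g f ∘ copair S (inj2 S B A) (inj1 S B A) = copair S f g.
  by apply: copair_unique; rewrite -comp_assoc ?copair1 ?copair2 ?copair1 ?copair2.
exists (copair S (inj2 S B A) (inj1 S B A) ∘ k).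
split; last by rewrite comp_assoc swap.
have k1 : k ∘ f = inj1 S A B.
  by rewrite -(@copair1 _ S _ _ _ f g) comp_assoc kf comp_idl.
have k2 : k ∘ g = inj2 S A B.
  by rewrite -(@copair2 _ S _ _ _ f g) comp_assoc kf comp_idl.
by apply: copair_unique;
  rewrite -!comp_assoc ?copair1 ?copair2 ?k1 ?k2 ?copair1 ?copair2 comp_idl.
Qed.

End Prerequisites.

Section Counit.
Context (C : Category) (L : LocallyCartesianClosed C) (T : TerminalObject C)
  (S : DisjointFiniteSums C) (p : Poly T).

Let delta := diagonal L (pmid p).
Let nu := neg_diagonal L S (pmid p).
Let pi1 := pb1 L (pmid p) (pmid p).
Let pi2 := pb2 L (pmid p) (pmid p).

Definition derivative : Poly T :=
  MkPoly (bang T (boxtimes L S (pmid p))) (pi1 ∘ nu) (bang T (pE p)).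

Lemma counit_is_pullback : decidable L S delta ->
  is_pullback (copair S (pi2 ∘ nu) (idm (pE p)))
    (copair S (pi1 ∘ nu) (idm (pE p))) (pmid p) (pmid p).
Proof.
move=> [_ /copair_swap_iso iso_k].
have E1 : copair S (pi1 ∘ nu) (idm (pE p)) = pi1 ∘ copair S nu delta.
  by apply: copair_unique; rewrite -comp_assoc ?copair1 ?copair2 ?pb_pair1.
have E2 : copair S (pi2 ∘ nu) (idm (pE p)) = pi2 ∘ copair S nu delta.
  by apply: copair_unique; rewrite -comp_assoc ?copair1 ?copair2 ?pb_pair2.
rewrite E1 E2; apply: iso_is_pullback iso_k.
(* The top edge is [pi2] and the left edge [pi1], hence the transposed square. *)
exact: is_pullback_sym (pb_is_pullback L (pmid p) (pmid p)).
Qed.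

Section Transpose.
Context (A : Poly T) (u : pE A ~> pE p) (v : pB A ~> pE p) (b : pB A ~> pB p).
Hypothesis uv_pullback :
  is_pullback (copair S u v) (copair S (pmid A) (idm (pB A))) (pmid p) b.

Lemma pmid_v : pmid p ∘ v = b.
Proof.
have [c _] := uv_pullback.
by have := f_equal (fun k => k ∘ inj2 S _ _) c; rewrite -!comp_assoc !copair2 comp_idr.
Qed.

Lemma uv_jointly_monic (Q : C) (x y : Q ~> sum S (pE A) (pB A)) :
  copair S u v ∘ x = copair S u v ∘ y ->
  copair S (pmid A) (idm (pB A)) ∘ x = copair S (pmid A) (idm (pB A)) ∘ y ->
  x = y.
Proof.
move=> e1 e2; have [c U] := uv_pullback.
have e : pmid p ∘ (copair S u v ∘ y)
       = b ∘ (copair S (pmid A) (idm (pB A)) ∘ y) by rewrite !comp_assoc c.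
have [z [_ zu]] := U _ _ _ e.
by rewrite -(zu x) ?e1 ?e2 // -(zu y).
Qed.

Lemma transpose_exists : exists g : pE A ~> boxtimes L S (pmid p),
  pi1 ∘ (nu ∘ g) = v ∘ pmid A /\ pi2 ∘ (nu ∘ g) = u.
Proof.
have e : pmid p ∘ (v ∘ pmid A) = pmid p ∘ u.
  have [c _] := uv_pullback.
  have := f_equal (fun k => k ∘ inj1 S _ _) c.
  by rewrite -!comp_assoc !copair1 comp_assoc pmid_v.
have [|g eg] := @neg_lift C L S T _ _ _ delta (pb_pair L e).
  move=> R x y xy.
  have e1 : x = v ∘ (pmid A ∘ y).
    have := f_equal (fun k => pi1 ∘ k) xy.
    by rewrite /= !comp_assoc !pb_pair1 comp_idl.
  have e2 : x = u ∘ y.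
    have := f_equal (fun k => pi2 ∘ k) xy.
    by rewrite /= !comp_assoc !pb_pair2 comp_idl.
  (* Where [<v q, u>] meets the diagonal, both legs of the pullback identify a point of [pE A] with
     its image in the other summand. *)
  have disj : inj1 S (pE A) (pB A) ∘ y = inj2 S (pE A) (pB A) ∘ (pmid A ∘ y).
    apply: uv_jointly_monic; rewrite !comp_assoc ?copair1 ?copair2 ?comp_idl //.
    by rewrite -e2 e1 comp_assoc.
  have [_ U] := inj_disjoint S (pE A) (pB A).
  by have [z _] := U _ _ _ disj; apply: (inhabits z).
by exists g; rewrite [nu ∘ g]eg pb_pair1 pb_pair2.
Qed.

Lemma transpose_is_pullback (g : pE A ~> boxtimes L S (pmid p)) :
  pi1 ∘ (nu ∘ g) = v ∘ pmid A -> pi2 ∘ (nu ∘ g) = u ->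
  is_pullback g (pmid A) (pi1 ∘ nu) v.
Proof.
move=> g1 g2; split; first by rewrite -comp_assoc.
move=> Q a c; rewrite -comp_assoc => ac.
have e : pmid p ∘ (pi2 ∘ (nu ∘ a)) = b ∘ c.
  by rewrite comp_assoc -pb_comm -comp_assoc ac comp_assoc pmid_v.
have [_ U] := uv_pullback.
(* [w] is the point of [pE A + pB A] with coordinates [pi2 ν a] and [c]. *)
have [w [[w1 w2] wu]] := U _ _ _ e.
have [|s ws] := @factor_inj1 C L S T _ _ _ w.
  move=> R x y xy.
  have cy : c ∘ y = x by rewrite -w2 -comp_assoc -xy comp_assoc copair2 comp_idl.
  (* On the part of [w] in the second summand, both coordinates of [ν a] equal [v x]. *)
  apply: (@neg_disjoint C L S _ _ _ delta (v ∘ x) (a ∘ y)).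
  apply: pb_unique; rewrite comp_assoc ?pb_pair1 ?pb_pair2 comp_idl.
    by rewrite -cy comp_assoc -ac -!comp_assoc.
  rewrite -(@copair2 _ S _ _ _ u v) -comp_assoc xy comp_assoc w1.
  by rewrite -!comp_assoc.
exists s; split.
  have qs : pmid A ∘ s = c by rewrite -w2 -ws comp_assoc copair1.
  split=> //; apply: (@neg_monic C L S T _ _ delta); apply: pb_unique.
    by rewrite (comp_assoc _ g) (comp_assoc _ _ s) g1 -comp_assoc qs ac.
  by rewrite (comp_assoc _ g) (comp_assoc _ _ s) g2 -w1 -ws comp_assoc copair1.
(* [inj1 ∘ t] has the same coordinates as [w]. *)
move=> t [t1 t2]; apply: (@inj1_monic C S (pE A) (pB A)).
rewrite ws; apply: wu; split; rewrite comp_assoc copair1 //.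
by rewrite -g2 -t1 -!comp_assoc.
Qed.

End Transpose.
End Counit.

Theorem proposition5p1p4 (C : Category) (L : LocallyCartesianClosed C)
    (T : TerminalObject C) (S : DisjointFiniteSums C) (p : Poly T)
    (delta_decidable : decidable L S (diagonal L (pmid p))) :
  is_derivative L S p
    (MkPoly (bang T (boxtimes L S (pmid p)))
            (comp (pb1 L (pmid p) (pmid p)) (neg_diagonal L S (pmid p)))
            (bang T (pE p))).
Proof.
pose eps : times_one L T S (derivative L S p) ~> p :=
  @MkPolyHom C T (times_one L T S (derivative L S p)) p _ _
    (counit_is_pullback delta_decidable).
exists eps => A f.
pose u : pE A ~> pE p := phE f ∘ inj1 S (pE A) (pB A).
pose v : pB A ~> pE p := phE f ∘ inj2 S (pE A) (pB A).
have fuv : phE f = copair S u v.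
  by apply: copair_unique; rewrite ?copair1 ?copair2.
have uv_pb := ph_pullback f; rewrite fuv in uv_pb.
have [g [g1 g2]] := @transpose_exists C L T S p A u v (phB f) uv_pb.
exists (@MkPolyHom C T A (derivative L S p) _ _
          (@transpose_is_pullback C L T S p A u v (phB f) uv_pb g g1 g2)); split.
  apply: poly_hom_eq => /=; last exact: (@pmid_v C T S p A u v (phB f) uv_pb).
  rewrite fuv; apply: copair_unique;
    rewrite -comp_assoc ?copair1 ?copair2 comp_assoc ?copair1 ?copair2 ?comp_idl //.
  by rewrite -comp_assoc.
move=> h eh.
(* The second summand forces [phB h], the first forces [pi2 ν (phE h)], and the square of [h] forces
   [pi1 ν (phE h)]. *)
have e := f_equal phE eh; rewrite /= fuv in e.
have hv : v = phB h.
  have := f_equal (fun k => k ∘ inj2 S _ _) e.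
  by rewrite /= -comp_assoc !copair2 comp_assoc copair2 comp_idl.
have hu : pb2 L (pmid p) (pmid p) ∘ (neg_diagonal L S (pmid p) ∘ phE h) = u.
  have := f_equal (fun k => k ∘ inj1 S _ _) e.
  by rewrite /= -comp_assoc !copair1 comp_assoc copair1 -comp_assoc.
apply: poly_hom_eq => //=.
apply: (@neg_monic C L S T _ _ (diagonal L (pmid p))); apply: pb_unique.
  have [c _] := ph_pullback h; rewrite /= -comp_assoc in c.
  by rewrite [LHS]g1 [RHS]c hv.
by rewrite [LHS]g2 [RHS]hu.
Qed.
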